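(* Let $\alpha\in(0,1)$ and let $\mathfrak{X}\subseteq [a_1,b_1]\times\cdots\times[a_M,b_M]$. The problem $$\max_{x\in\mathfrak{X}}\ \min_{P\in\mathcal{P}_B(\alpha)}\ \mathbb{E}_P[u(x;V)]$$ is equivalent to $$\begin{aligned} \max_{x,y,z,\eta,\pi,\tau}\ & \bar V_{I-1}^T\eta+\pi+\tau\\ \text{s.t.}\ \ & C^T\eta+e_I\tau\le Yy+Zz,\\ & N^{-1/2}\,\hat T_{1-\alpha}^T\left(S_{I-1}^{1/2}\right)^T\eta+e_{\lceil(1-\alpha)K\rceil}\,\pi\le 0,\\ & E^Tz=e_M,\\ & E^Ty=x,\\ & H^-z-y\le 0,\\ & H^+z-y\ge 0,\\ & z\in\{0,1\}^I,\\ & x\in\mathfrak{X}, \end{aligned}$$ where $y\in\mathbb{R}^I$, $\eta\in\mathbb{R}^{I-1}$, $\pi,\tau\in\mathbb{R}$.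
   Context: ''Equivalent'' means that the two problems have the same optimal value and the same optimal decisions $x$. Throughout, $e_k$ is the all-ones vector in $\mathbb{R}^k$, and $\lceil\cdot\rceil$ is the ceiling function. Utility. There are $M$ attributes; $\mathfrak{M}=\{1,\dots,M\}$. For each $m\in\mathfrak M$, breakpoints $a_m=t_{m,0}<t_{m,1}<\cdots<t_{m,I_m}=b_m$ are given, $\mathfrak I_m=\{1,\dots,I_m\}$ and $I=\sum_m I_m$. For $v=(v_1^T,\dots,v_M^T)^T\in\mathbb{R}^I$ with $v_m=(v_{m,1},\dots,v_{m,I_m})^T$, let $$u_m(x_m;v_m)=\sum_{i\in\mathfrak I_m}\left[\frac{v_{m,i}}{t_{m,i}-t_{m,i-1}}(x_m-t_{m,i-1})+\sum_{j=1}^{i-1}v_{m,j}\right]\mathbf 1\{t_{m,i-1}<x_m\le t_{m,i}\},\qquad u(x;v)=\sum_{m\in\mathfrak M}u_m(x_m;v_m).$$ The increments form a random vector $V$ supported in $\mathcal V=\{v\in\mathbb{R}^I: e_I^Tv=1,\ v\ge0\}$. Bootstrap ambiguity set. $V^1,\dots,V^N$ is an i.i.d. sample of $V$ with sample mean $\bar V$ and sample covariance matrix $S$. $C=[\,\mathrm{Id}_{I-1}\ |\ 0\,]$ is the $(I-1)\times I$ matrix extracting the first $I-1$ components; $\bar V_{I-1}=C\bar V$, $S_{I-1}=CSC^T$. The covariance matrix of $CV$ is assumed nonsingular, and $S_{I-1}$ is assumed nonsingular. $S_{I-1}^{1/2}$ is a full rank matrix with $S_{I-1}=(S_{I-1}^{1/2})^TS_{I-1}^{1/2}$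 (and likewise for the bootstrap covariances below). Generate $K$ nonparametric bootstrap resamples, each of size $N$, from the empirical distribution of $CV^1,\dots,CV^N$; let $\bar V_{I-1}^{*,k}$, $S_{I-1}^{*,k}$ be the sample mean and (nonsingular) sample covariance matrix of the $k$-th resample, and $$T_k^*=\sqrt N\,(S_{I-1}^{*,k})^{-1/2}(\bar V_{I-1}^{*,k}-\bar V_{I-1}),\qquad k=1,\dots,K.$$ Tukey's depth of a point $x$ under a distribution $\mathcal F$ is $\mathrm{TD}(\mathcal F,x)=\inf_{\|s\|=1}\int\mathbf 1\{s^T(y-x)\ge0\}\,d\mathcal F(y)$. Let $\mathcal F_K^*$ be the empirical distribution of $T_1^*,\dots,T_K^*$, and let $T_{(1)}^*,\dots,T_{(K)}^*$ be these statistics ordered by decreasing depth $\mathrm{TD}(\mathcal F_K^*,\cdot)$. Let $\hat T_{1-\alpha}=[T_{(1)}^*,\dots,T_{(\lceil(1-\alpha)K\rceil)}^*]$, an $(I-1)\times\lceil(1-\alpha)K\rceil$ matrix, and $$\mathfrak W_{1-\alpha}^*=\{\hat T_{1-\alpha}w: e_{\lceil(1-\alpha)K\rceil}^Tw=1,\ w\ge0\},\qquad \mathfrak C_{1-\alpha}^*=\{\bar V_{I-1}-S_{I-1}^{1/2}\tilde w/\sqrt N:\ \tilde w\in\mathfrak W_{1-\alpha}^*\}.$$ With $\mathscr P(\mathbb{R}^I)$ the set of probability measures on $\mathbb{R}^I$, $$\mathcal P_B(\alpha)=\{P\in\mathscr P(\mathbb{R}^I):\ P(V\in\mathcal V)=1,\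 C\,\mathbb{E}_P[V]\in\mathfrak C_{1-\alpha}^*\}.$$ Matrices. $Y,Z,H^-,H^+$ are $I\times I$ block-diagonal with blocks indexed by $m\in\mathfrak M$, each $I_m\times I_m$: $Y_m=\mathrm{diag}\left(\frac1{t_{m,1}-t_{m,0}},\dots,\frac1{t_{m,I_m}-t_{m,I_m-1}}\right)$; $Z_m$ is upper triangular with $i$-th diagonal entry $\frac{-t_{m,i-1}}{t_{m,i}-t_{m,i-1}}$ and all entries strictly above the diagonal equal to $1$; $H_m^-=\mathrm{diag}(t_{m,0},\dots,t_{m,I_m-1})$; $H_m^+=\mathrm{diag}(t_{m,1},\dots,t_{m,I_m})$. $E$ is the $I\times M$ block-diagonal matrix with diagonal blocks $e_{I_1},\dots,e_{I_M}$. *)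

(* Defs.v *)
From HB Require Import structures.
From mathcomp Require Import all_boot all_order all_algebra.
From mathcomp Require Import all_classical all_reals all_analysis.

Set Implicit Arguments.
Unset Strict Implicit.
Unset Printing Implicit Defensive.

Import Order.TTheory GRing.Theory Num.Theory.
Import numFieldNormedType.Exports.

Local Open Scope classical_set_scope.
Local Open Scope ring_scope.

(* R^n with its Borel sigma-algebra. *)
Notation borelV R n := (g_sigma_algebraType (@open 'cV[R]_n)).

Definition lemx (R : realType) m n (A B : 'M[R]_(m, n)) : Prop :=
  forall i j, A i j <= B i j.

(* Vectors w >= 0 with e^T w = 1; serves both as the support of the increments
   and as the set of convex weights. *)
Definition unit_simplex (R : realType) n : set 'cV[R]_n :=
  [set v | (const_mx 1 : 'cV[R]_n)^T *m v = 1%:M /\ lemx 0 v].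

(* Indices are shifted by one: i : 'I_n stands for the interval
   ]t_i, t_(i+1)], and only t_0, ..., t_n are used. *)
Definition marginal_utility (R : realType) n (t : nat -> R) (x : R)
    (v : 'cV[R]_n) : R :=
  \sum_(i < n)
    (v i 0 / (t i.+1 - t i) * (x - t i) + \sum_(j < n | (j < i)%N) v j 0)
      * (t i < x <= t i.+1)%R%:R.

Section Blocks.
Variables (R : realType) (M : nat) (p : 'I_M -> nat) (t : 'I_M -> nat -> R).

(* The vectors of R^I, I = \sum_m p m, have blocks v_m = submxcol v m. *)
Definition utility (x : 'cV[R]_M) (v : 'cV[R]_(\sum_(m < M) p m)) : R :=
  \sum_(m < M) marginal_utility (t m) (x m 0) (submxcol v m).

Definition attribute_box : set 'cV[R]_M :=
  [set x | forall m, t m 0%N <= x m 0 <= t m (p m)].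

Definition matY : 'M[R]_(\sum_(m < M) p m) :=
  \mxdiag_(m < M) diag_mx (\row_(i < p m) (t m i.+1 - t m i)^-1).

Definition matZ : 'M[R]_(\sum_(m < M) p m) :=
  \mxdiag_(m < M) \matrix_(i < p m, j < p m)
    (if (i : nat) == j then - t m i / (t m i.+1 - t m i)
     else if (i < j)%N then 1 else 0).

Definition matHminus : 'M[R]_(\sum_(m < M) p m) :=
  \mxdiag_(m < M) diag_mx (\row_(i < p m) t m i).

Definition matHplus : 'M[R]_(\sum_(m < M) p m) :=
  \mxdiag_(m < M) diag_mx (\row_(i < p m) t m i.+1).

Definition matE : 'M[R]_(\sum_(m < M) p m, M) :=
  \mxcol_(m < M) \matrix_(i < p m, l < M) (m == l)%:R.

End Blocks.

(* [Id_(n-1) | 0] *)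
Definition matC (R : realType) n : 'M[R]_(n.-1, n) :=
  \matrix_(i < n.-1, j < n) ((i : nat) == j)%:R.

Section Samples.
Variables (R : realType) (n N : nat).
Implicit Type X : 'I_N -> 'cV[R]_n.

Definition sample_mean X : 'cV[R]_n := N%:R^-1 *: \sum_(j < N) X j.

Definition sample_cov X : 'M[R]_n :=
  N.-1%:R^-1 *:
    \sum_(j < N) (X j - sample_mean X) *m (X j - sample_mean X)^T.

End Samples.

Definition mean_vec (R : realType) n (P : probability (borelV R n) R) :
    'cV[R]_n :=
  \col_i fine 'E_P[fun v : borelV R n => (v : 'cV[R]_n) i 0].

(* Covariance matrix of B V when V has distribution P. *)
Definition cov_mx (R : realType) n k (P : probability (borelV R n) R)
    (B : 'M[R]_(k, n)) : 'M[R]_k :=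
  \matrix_(i, j) fine (covariance P
    (fun v : borelV R n => (B *m (v : 'cV[R]_n)) i 0)
    (fun v : borelV R n => (B *m (v : 'cV[R]_n)) j 0)).

Definition is_sqrt_mx (R : realType) n (A L : 'M[R]_n) : Prop :=
  \rank L = n /\ A = L^T *m L.

(* V_1, ..., V_N have common law mu, the resampled indices J_(k, j) are uniform
   on 'I_N, and all of these variables are mutually independent.  The j-th
   point of the k-th bootstrap resample is the sample point of index J_(k, j). *)
Definition bootstrap_sampling (R : realType) n N K d (Om : measurableType d)
    (Pr : probability Om R) (mu : probability (borelV R n) R)
    (V : 'I_N -> Om -> borelV R n) (J : 'I_K -> 'I_N -> Om -> 'I_N) : Prop :=
  [/\ forall j, measurable_fun setT (V j),
      forall k j i, measurable (J k j @^-1` [set i]) &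
      forall (A : 'I_N -> set (borelV R n)) (r : 'I_K -> 'I_N -> 'I_N),
        (forall j, measurable (A j)) ->
        Pr [set w | (forall j, A j (V j w)) /\ (forall k j, J k j w = r k j)]
        = ((\prod_(j < N) mu (A j)) * (N%:R ^- (K * N))%:E)%E].

Section TukeyDepth.
Variables (R : realType) (n : nat).

Definition euclidean_norm (s : 'cV[R]_n) : R :=
  Num.sqrt (\sum_(i < n) s i 0 ^+ 2).

Definition tukey_depth (F : {measure set (borelV R n) -> \bar R})
    (x : 'cV[R]_n) : \bar R :=
  ereal_inf
    [set (\int[F]_y
            (\1_[set y : borelV R n |
                 (0 <= (s^T *m ((y : 'cV[R]_n) - x)) 0 0)%R] y)%:E)%E
    | s in [set s : 'cV[R]_n | euclidean_norm s = 1]].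

Definition empirical_dist (s : seq 'cV[R]_n) :
    {measure set (borelV R n) -> \bar R} :=
  mscale ((size s)%:R^-1)%:nng
    (msum (fun k => \d_(nth 0 s k : borelV R n)) (size s)).

(* s lists the points T_k by decreasing depth; ties are broken arbitrarily. *)
Definition depth_ordered K (T : 'I_K -> 'cV[R]_n) (s : seq 'cV[R]_n) : Prop :=
  let l := [seq T k | k <- enum 'I_K] in
  let D := tukey_depth (empirical_dist l) in
  perm_eq s l /\ sorted (fun a b => (D b <= D a)%E) s.

End TukeyDepth.

Section Bootstrap.
Variables (R : realType) (n N K : nat).
Implicit Types (V : 'I_N -> 'cV[R]_n) (r : 'I_K -> 'I_N -> 'I_N).

Definition resample V r (k : 'I_K) (j : 'I_N) : 'cV[R]_n.-1 :=
  matC R n *m V (r k j).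

(* Lstar k plays the role of the square root of the k-th resample covariance. *)
Definition boot_stat V r (Lstar : 'I_K -> 'M[R]_n.-1) (k : 'I_K) :
    'cV[R]_n.-1 :=
  Num.sqrt N%:R *:
    (invmx (Lstar k) *m
       (sample_mean (resample V r k) - matC R n *m sample_mean V)).

End Bootstrap.

Definition depth_count (R : realType) (alpha : R) (K : nat) : nat :=
  `|Num.ceil ((1 - alpha) * K%:R)|%N.

(* Columns: the q first points of s. *)
Definition mat_That (R : realType) n q (s : seq 'cV[R]_n) : 'M[R]_(n, q) :=
  \matrix_(i, j) (nth 0 s j : 'cV[R]_n) i 0.

Definition confidence_region (R : realType) n q (N : nat) (Vbar : 'cV[R]_n)
    (L : 'M[R]_n) (That : 'M[R]_(n, q)) : set 'cV[R]_n :=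
  [set Vbar - (Num.sqrt N%:R)^-1 *: (L *m w)
  | w in [set That *m w | w in @unit_simplex R q]].

Definition ambiguity_set (R : realType) n (CR : set 'cV[R]_n.-1) :
    set (probability (borelV R n) R) :=
  [set P : probability (borelV R n) R |
     P (@unit_simplex R n : set (borelV R n)) = 1%E
     /\ CR (matC R n *m mean_vec P)].

Section Problems.
Local Open Scope ereal_scope.
Variables (R : realType) (T : Type).

Definition sup_value (feas : set T) (f : T -> \bar R) : \bar R :=
  ereal_sup [set f x | x in feas].

Definition maximizers (feas : set T) (f : T -> \bar R) : set T :=
  [set x | feas x /\ forall y, feas y -> f y <= f x].

Definition worst_case (Q : Type) (PB : set Q) (g : T -> Q -> \bar R) (x : T) :
    \bar R :=
  ereal_inf [set g x P | P in PB].

(* The inner minimum has to be attained: when PB is empty the worst case is +oo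
   everywhere, but no decision is optimal. *)
Definition maximin_decisions (Q : Type) (feas : set T) (PB : set Q)
    (g : T -> Q -> \bar R) : set T :=
  [set x | maximizers feas (worst_case PB g) x /\
           exists2 P, PB P & g x P = worst_case PB g x].

End Problems.

Definition expected_utility (R : realType) M (p : 'I_M -> nat)
    (t : 'I_M -> nat -> R) (x : 'cV[R]_M)
    (P : probability (borelV R (\sum_(m < M) p m)) R) : \bar R :=
  'E_P[fun v : borelV R (\sum_(m < M) p m) => utility t x v].

Record milp_point (R : realType) (M n : nat) := MilpPoint {
  milp_x : 'cV[R]_M;
  milp_y : 'cV[R]_n;
  milp_z : 'cV[R]_n;
  milp_eta : 'cV[R]_n.-1;
  milp_pi : R;
  milp_tau : R }.

Definition milp_objective (R : realType) M n (Vbar : 'cV[R]_n.-1)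
    (q : milp_point R M n) : \bar R :=
  ((Vbar^T *m milp_eta q) 0 0 + milp_pi q + milp_tau q)%:E.

Definition milp_feasible (R : realType) M (p : 'I_M -> nat)
    (t : 'I_M -> nat -> R) (X : set 'cV[R]_M) (N : nat)
    (L : 'M[R]_((\sum_(m < M) p m).-1)) (K' : nat)
    (That : 'M[R]_((\sum_(m < M) p m).-1, K')) :
    set (milp_point R M (\sum_(m < M) p m)) :=
  [set q | let: MilpPoint x y z eta pi tau := q in
    [/\ lemx ((matC R _)^T *m eta + tau *: const_mx 1)
             (matY p t *m y + matZ p t *m z),
        lemx ((Num.sqrt N%:R)^-1 *: (That^T *m L^T *m eta) + pi *: const_mx 1)
             0,
        (matE R p)^T *m z = const_mx 1 /\ (matE R p)^T *m y = x,
        lemx (matHminus p t *m z - y) 0 /\ lemx 0 (matHplus p t *m z - y) &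
        (forall i, z i 0 = 0 \/ z i 0 = 1) /\ X x]].

(* Main.v *)
Require Import Defs.
From HB Require Import structures.
From mathcomp Require Import all_boot all_order all_algebra.
From mathcomp Require Import all_classical all_reals all_analysis.
From mathcomp Require Import measurable_realfun ring lra.

Set Implicit Arguments.
Unset Strict Implicit.
Unset Printing Implicit Defensive.

Import Order.TTheory GRing.Theory Num.Theory.
Import numFieldNormedType.Exports.

Local Open Scope classical_set_scope.
Local Open Scope ring_scope.

(** Fix a decision x.  Its utility is linear in the increments, u(x; v) = g^T v,
and the coefficient vector g is exactly Y y + Z z for the pairs (y, z) which
the binary constraints of the program attach to x: the single 1 in a block of
z selects an interval ]t_(i-1), t_i] containing x_m, and the corresponding
entry of y carries x_m ([encodesP], [encodes_utility]).  At a breakpoint two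
intervals qualify; they give the same g, by continuity of u.

The expectation of a linear form depends on P only through its mean, which
lies in the simplex when P is supported there ([mean_vec_simplex]), and every
point of the simplex is the mean of a Dirac mass.  Hence the inner problem is
the finite linear program: minimize g^T m over m in the simplex subject to
C m in the confidence polytope.  With the weights w of the bootstrap points as
additional variables, its constraints are C m + G w = vbar with m and w in
simplices, where G = N^(-1/2) L That ([expected_utility_primal]).  The
remaining constraints and the objective of the program are those of the dual
linear program, and its variables eta, pi, tau are the three groups of
multipliers.

The dual is always feasible (take eta = pi = 0 and tau very negative), so by
strong duality either both programs are attained with the same value, or the
primal is infeasible and the dual is unbounded ([inner_strong]).  In the first
case x and its optimal multipliers form a feasible point of the program whose
objective is the worst case at x.  In the second case the ambiguity set is
empty, both values are infinite as soon as there is a feasible decision, and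
neither problem has an optimal decision.  The passage from this dichotomy to
equality of values and of optimal decisions is purely order theoretic
([maximin_value], [maximin_decisionsE]).

Strong duality is derived from Farkas' lemma, which is proved here over any
ordered field by induction on the number of inequalities. *)

(** * Farkas' lemma and linear programming duality *)

Lemma form_subZ (R : realFieldType) n (e : 'rV[R]_n) (x y : 'cV[R]_n) s :
  (e *m (x - s *: y)) 0 0 = (e *m x) 0 0 - s * (e *m y) 0 0.
Proof. by rewrite mulmxBr -scalemxAr [LHS]mxE [X in _ + X]mxE [X in _ - X]mxE. Qed.

(** Bartl's induction.  If c is not already a consequence of the constraints
other than a_0, some x0 violates c while respecting them, and then a_0 must be
positive at x0.  Projecting along x0 onto the kernel of a_0 eliminates a_0; the
multipliers found for the projected forms also work before projection, and the
multiplier that a_0 receives is nonnegative by the choice of x0. *)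
Lemma farkas (R : realFieldType) n k (a : 'I_k -> 'rV[R]_n) (c : 'rV[R]_n) :
  (forall x : 'cV[R]_n, (forall i, (a i *m x) 0 0 <= 0) -> (c *m x) 0 0 <= 0) ->
  exists2 l : 'I_k -> R, (forall i, 0 <= l i) & c = \sum_i l i *: a i.
Proof.
elim: k a c => [|k IH] a c H.
  exists (fun=> 0) => //; rewrite big_ord0; apply/rowP => j; rewrite mxE.
  have := H (c 0 j *: delta_mx j 0).
  rewrite -scalemxAr -colE !mxE -expr2 => h; apply/eqP.
  rewrite -sqrf_eq0 eq_le sqr_ge0 andbT.
  by apply: h; case.
pose a' i := a (lift ord0 i).
have [/IH[l l0 ->]|] := pselect (forall x : 'cV[R]_n,
    (forall i, (a' i *m x) 0 0 <= 0) -> (c *m x) 0 0 <= 0).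
  exists (fun i => if unlift ord0 i is Some j then l j else 0).
    by move=> i; case: unliftP.
  rewrite big_ord_recl unlift_none scale0r add0r.
  by apply: eq_bigr => i _; rewrite liftK.
move=> /existsNP[x0 /not_implyP[ax0 /negP]]; rewrite -ltNge => cx0.
set s := (a ord0 *m x0) 0 0.
have s_gt0 : 0 < s.
  rewrite ltNge; apply/negP => sle0; move: cx0; rewrite ltNge H // => i.
  by case: (unliftP ord0 i) => [j ->|->] //; exact: ax0.
(* b e is the form e precomposed with the projection along x0 onto ker a_0. *)
pose b (e : 'rV[R]_n) := e - ((e *m x0) 0 0 / s) *: a ord0.
have bE e x : (b e *m x) 0 0 = (e *m (x - ((a ord0 *m x) 0 0 / s) *: x0)) 0 0.
  rewrite form_subZ mulmxBl -scalemxAl [LHS]mxE [X in _ + X]mxE [X in _ - X]mxE.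
  by congr (_ - _); rewrite mulrC mulrA mulrAC.
have /IH[l l0 cE] : forall x : 'cV[R]_n,
    (forall i, (b (a' i) *m x) 0 0 <= 0) -> (b c *m x) 0 0 <= 0.
  move=> x hx; rewrite bE; apply: H => i; case: (unliftP ord0 i) => [j ->|->].
    by rewrite -bE; exact: hx.
  by rewrite form_subZ divfK ?subrr //; exact: lt0r_neq0.
pose l_ord0 := ((c *m x0) 0 0 - \sum_i l i * (a' i *m x0) 0 0) / s.
exists (fun i => if unlift ord0 i is Some j then l j else l_ord0).
  move=> i; case: unliftP => // _; apply: divr_ge0; last exact: ltW.
  rewrite subr_ge0; apply: (@le_trans _ _ 0); last exact: ltW.
  by apply: sumr_le0 => j _; apply: mulr_ge0_le0 => //; exact: ax0.
rewrite big_ord_recl unlift_none.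
rewrite (eq_bigr (fun i => l i *: b (a' i) + (l i * (a' i *m x0) 0 0 / s) *: a ord0));
    last by move=> i _; rewrite liftK /b scalerBr scalerA mulrA subrK.
rewrite big_split /= -cE -scaler_suml /b /l_ord0 -mulr_suml addrCA addrA.
by rewrite -addrA -scalerDl -mulrDl subrK subrK.
Qed.

(** Homogenization: when G u <= h has no solution, every (u, s) satisfying
G u <= s h has s <= 0, so Farkas' lemma writes the form (u, s) |-> s as a
nonnegative combination of the rows of [G, -h]. *)
Lemma farkas_alternative (R : realType) n k (G : 'M[R]_(k, n)) (h : 'cV[R]_k) :
  ~ (exists u, lemx (G *m u) h) ->
  exists l : 'cV[R]_k,
    [/\ lemx 0 l, l^T *m G = 0 & (l^T *m h) 0 0 < 0].
Proof.
move=> noG.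
pose GH : 'M[R]_(k, n + 1) := row_mx G (- h).
have [|l l0 E] := @farkas R (n + 1) k (fun i => row i GH) (row_mx 0 1).
  move=> x; rewrite -(vsubmxK x) mul_row_col mul0mx add0r mul1mx => hx.
  set s := dsubmx x 0 0 => /=; rewrite leNgt; apply/negP => s0; apply: noG.
  exists (s^-1 *: usubmx x) => i j; rewrite ord1.
  have := hx i; rewrite -row_mul mul_row_col mulNmx mxE mxE [X in _ + X]mxE.
  rewrite [X in _ - X]mxE big_ord1 -/s subr_le0 mulrC => hxi.
  by rewrite -scalemxAr mxE ler_pdivrMl.
have EE : (\col_i l i)^T *m GH = row_mx 0 1.
  rewrite E; apply/rowP => j; rewrite !mxE summxE.
  by apply: eq_bigr => i _; rewrite !mxE.
exists (\col_i l i).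
move: EE; rewrite mul_mx_row => /eq_row_mx[-> E2]; split => //.
  by move=> i j; rewrite !mxE.
move/matrixP/(_ 0 0): E2; rewrite mulmxN [LHS]mxE [RHS]mxE eqxx => E2.
by rewrite -oppr_gt0 E2.
Qed.

Lemma mulmx_monor (R : realType) n (y a b : 'cV[R]_n) :
  lemx 0 y -> lemx a b -> (y^T *m a) 0 0 <= (y^T *m b) 0 0.
Proof.
move=> y0 ab; rewrite [leLHS]mxE [leRHS]mxE; apply: ler_sum => i _.
by rewrite mxE ler_wpM2l //; have := y0 i 0; rewrite mxE.
Qed.

Lemma trmx_form (R : realType) n (a b : 'cV[R]_n) :
  (a^T *m b) 0 0 = (b^T *m a) 0 0.
Proof. by rewrite -[in RHS](trmxK a) -trmx_mul [RHS]mxE. Qed.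

Lemma lemx_col_mx (R : realType) k1 k2 n (a c : 'M[R]_(k1, n)) (b d : 'M[R]_(k2, n)) :
  lemx (col_mx a b) (col_mx c d) <-> lemx a c /\ lemx b d.
Proof.
split=> [h|[h1 h2] i j].
  split=> i j; first by have := h (lshift _ i) j; rewrite !col_mxEu.
  by have := h (rshift _ i) j; rewrite !col_mxEd.
by case: (split_ordP i) => i' ->; rewrite ?col_mxEu ?col_mxEd; [exact: h1|exact: h2].
Qed.

Lemma lemx0_col_mx (R : realType) k1 k2 n (a : 'M[R]_(k1, n)) (b : 'M[R]_(k2, n)) :
  lemx 0 (col_mx a b) <-> lemx 0 a /\ lemx 0 b.
Proof. by rewrite -[X in lemx X]col_mx0; exact: lemx_col_mx. Qed.

(** A solution of the system formed by primal feasibility, dual feasibility and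
c^T x <= b^T y is an optimal pair.  Otherwise a certificate (xi, rho, th) of
infeasibility of this system satisfies A xi = th b, A^T rho + th c >= 0 and
c^T xi + b^T rho < 0.  If th > 0, scaling by 1/th contradicts weak duality; if
th = 0, then c^T xi >= 0 because the dual is feasible, so - rho is a ray along
which the dual objective is unbounded. *)
Lemma lp_duality (R : realType) n k (A : 'M[R]_(k, n)) (b : 'cV[R]_k) (c : 'cV[R]_n) :
  (exists y, lemx (A^T *m y) c) ->
  (exists x y, [/\ lemx 0 x, A *m x = b, lemx (A^T *m y) c &
                    (c^T *m x) 0 0 = (b^T *m y) 0 0]) \/
  (exists2 r : 'cV[R]_k, lemx (A^T *m r) 0 & 0 < (b^T *m r) 0 0).
Proof.
move=> [y0 y0c].
pose G : 'M[R]_(n + (n + (k + (k + 1))), n + k) :=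
  col_mx (row_mx 0 A^T) (col_mx (row_mx (- 1%:M : 'M[R]_n) 0)
    (col_mx (row_mx A 0) (col_mx (row_mx (- A) 0) (row_mx c^T (- b^T))))).
pose h : 'cV[R]_(n + (n + (k + (k + 1)))) :=
  col_mx c (col_mx 0 (col_mx b (col_mx (- b) 0))).
have weak (x : 'cV[R]_n) (y : 'cV[R]_k) : lemx 0 x -> lemx (A^T *m y) c ->
    ((A *m x)^T *m y) 0 0 <= (c^T *m x) 0 0.
  move=> x0 yc; rewrite trmx_mul -mulmxA [leRHS]trmx_form.
  exact: mulmx_monor.
have [[u Gu]|/farkas_alternative[l []]] := pselect (exists u, lemx (G *m u) h).
  left; exists (usubmx u), (dsubmx u).
  move: Gu; rewrite /G /h -{1}(vsubmxK u) !mul_col_mx !mul_row_col !mul0mx !mulNmx.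
  rewrite mul1mx !addr0 add0r !lemx_col_mx => -[yc [x0 [Axb1 [Axb2 v]]]].
  have x_ge0 : lemx 0 (usubmx u).
    by move=> i j; have := x0 i j; rewrite !mxE oppr_le0.
  have Axb : A *m usubmx u = b.
    apply/matrixP => i j; apply/le_anti/andP; split; first exact: Axb1.
    by have := Axb2 i j; rewrite [leLHS]mxE [leRHS]mxE lerN2.
  split => //; apply/le_anti/andP; split.
    by have := v 0 0; rewrite [leLHS]mxE [X in _ + X]mxE [leRHS]mxE subr_le0.
  by rewrite -Axb; exact: weak.
(* Multipliers: xi of A^T y <= c, sg of - x <= 0, r1 and r2 of the two halves of
   A x = b, th of c^T x <= b^T y. *)
rewrite -(vsubmxK l) -(vsubmxK (dsubmx l)) -(vsubmxK (dsubmx (dsubmx l))).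
rewrite -(vsubmxK (dsubmx (dsubmx (dsubmx l)))).
set xi := usubmx l; set sg := usubmx _; set r1 := usubmx _; set r2 := usubmx _.
set th := dsubmx _.
rewrite !lemx0_col_mx /G /h !tr_col_mx !mul_row_col !mul_mx_row !mulmx0 !mulmxN.
rewrite !add_row_mx -(row_mx0 R 1 n k) !add0r addr0 mulmx1.
move=> [xi0 [sg0 [_ [_ th0]]]] /eq_row_mx[E1 E2].
set rho := r1 - r2; set th1 := th 0 0.
have th1_ge0 : 0 <= th1 by have := th0 0 0; rewrite mxE.
have thE : th^T = th1%:M by rewrite [th]mx11_scalar tr_scalar_mx.
have Axi : A *m xi = th1 *: b.
  apply: trmx_inj; rewrite trmx_mul linearZ /= -mul_scalar_mx -thE.
  exact: subr0_eq E2.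
have Arho : A^T *m rho = sg - th1 *: c.
  apply: trmx_inj; rewrite trmx_mul trmxK !linearB /=.
  rewrite linearZ /= -mul_scalar_mx -thE mulmxBl.
  move/eqP: E1; rewrite addrC subr_eq0 addrA => /eqP <-.
  by rewrite addrK.
have -> : xi^T *m c + (r1^T *m b - r2^T *m b) = xi^T *m c + rho^T *m b.
  by rewrite -mulmxBl /rho [in RHS]linearB.
rewrite mxE [X in X + _]trmx_form [X in _ + X]trmx_form => neg.
move: th1_ge0; rewrite le_eqVlt => /orP[/eqP th1_0|th1_gt0].
  right; exists (- rho).
    rewrite mulmxN Arho -th1_0 scale0r subr0 => i j.
    by have := sg0 i j; rewrite !mxE oppr_le0.
  have := weak _ _ xi0 y0c; rewrite Axi -th1_0 scale0r trmx0 mul0mx mxE => cxi.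
  rewrite mulmxN [ltRHS]mxE; lra.
have /(weak _ _ xi0) : lemx (A^T *m (- th1^-1 *: rho)) c.
  rewrite -scalemxAr Arho scalerBr scalerA mulNr mulVf ?gt_eqF// => i j.
  rewrite mxE [X in X + _]mxE scaleN1r opprK mulNr gerDr oppr_le0.
  by have := sg0 i j; rewrite mxE => ?; rewrite mulr_ge0 // invr_ge0 ltW.
rewrite Axi [(_ *: b)^T]linearZ /= -scalemxAr -scalemxAl scalerA mulNr mulVf ?gt_eqF//.
by rewrite scaleN1r [leLHS]mxE; lra.
Qed.

(** * Expectations of laws supported in the simplex *)

Lemma measurable_coord (R : realType) n (i : 'I_n) :
  measurable_fun setT (fun v : borelV R n => (v : 'cV[R]_n) i 0).
Proof.
apply: (measurability _ (RGenOpens.measurableE R)) => _ [_ [a [b ->] <-]].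
rewrite setTI; apply: sub_sigma_algebra.
have /continuousP := @coord_continuous R n 1 i 0; apply; exact: interval_open.
Qed.

Lemma unit_simplexE (R : realType) n :
  @unit_simplex R n =
  [set v | \sum_i v i 0 = 1] `&` \bigcap_(i in [set: 'I_n]) [set v | 0 <= v i 0].
Proof.
have sumE (v : 'cV[R]_n) : ((const_mx 1 : 'cV[R]_n)^T *m v) 0 0 = \sum_i v i 0.
  by rewrite mxE; apply: eq_bigr => i _; rewrite !mxE mul1r.
apply/seteqP; split => v /=.
  move=> [v1 v0]; split; first by rewrite -sumE v1 mxE eqxx.
  by move=> i _; have := v0 i 0; rewrite mxE.
move=> [v1 v0]; split; last by move=> i j; rewrite mxE ord1; exact: v0.
by rewrite [LHS]mx11_scalar sumE v1.
Qed.

Lemma measurable_unit_simplex (R : realType) n :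
  measurable (@unit_simplex R n : set (borelV R n)).
Proof.
rewrite unit_simplexE; apply: measurableI.
  have ms : measurable_fun setT (fun v : borelV R n => \sum_i (v : 'cV[R]_n) i 0).
    apply: measurable_sum => i; exact: measurable_coord.
  have := ms measurableT [set 1] (measurable_set1 _).
  by rewrite setTI.
apply: fin_bigcap_measurable => // i _.
rewrite -[X in measurable X]setTI.
have := @measurable_coord R n i measurableT `[0, +oo[%classic.
rewrite (_ : _ @^-1` _ = [set v : borelV R n | 0 <= (v : 'cV[R]_n) i 0]).
  by apply; exact: measurable_itv.
by apply/seteqP; split => v /=; rewrite in_itv /= andbT.
Qed.

Section ExpectationOnSimplex.
Variables (R : realType) (n : nat) (P : probability (borelV R n) R).
Hypothesis PD : P (@unit_simplex R n : set (borelV R n)) = 1%E.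

Let D : set (borelV R n) := @unit_simplex R n.
Let mD : measurable D := @measurable_unit_simplex R n.

Lemma off_simplex_null : P (~` D) = 0%E.
Proof. by rewrite probability_setC // PD subee. Qed.

Lemma integrable_coord i :
  P.-integrable setT (fun v : borelV R n => ((v : 'cV[R]_n) i 0)%:E).
Proof.
have mi : measurable_fun setT (EFin \o (fun v : borelV R n => (v : 'cV[R]_n) i 0)).
  by apply/measurable_EFinP; exact: measurable_coord.
apply/(negligible_integrable (measurableC mD) measurableT mi off_simplex_null).
rewrite setTD setCK; apply: (@le_integrable _ _ _ _ _ mD _ (cst 1%E)).
- exact: measurable_funTS mi.
- move=> v; rewrite /D unit_simplexE => -[/= v1 v0]; rewrite lee_fin normr1.
  rewrite ger0_norm ?v0 // -v1 (bigD1 i) //= lerDl; apply: sumr_ge0 => j _; exact: v0.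
- exact: finite_measure_integrable_cst.
Qed.

Lemma expectation_form (c : 'cV[R]_n) :
  'E_P[fun v : borelV R n => ((c^T *m (v : 'cV[R]_n)) 0 0)%R]%E
  = ((c^T *m mean_vec P) 0 0)%:E.
Proof.
rewrite unlock.
rewrite (eq_integral (fun v : borelV R n =>
    (\sum_(i <- index_enum 'I_n) (c i 0)%:E * ((v : 'cV[R]_n) i 0)%:E)%E)); last first.
  by move=> v _; rewrite mxE -sumEFin; apply: eq_bigr => i _; rewrite mxE EFinM.
rewrite integral_sum //; last by move=> i; exact/integrableZl/integrable_coord.
rewrite mxE -sumEFin; apply: eq_bigr => i _.
rewrite integralZl //; last exact: integrable_coord.
rewrite !mxE EFinM unlock fineK //; apply: integrable_fin_num => //.
exact: integrable_coord.
Qed.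

Lemma mean_vec_simplex : unit_simplex (mean_vec P).
Proof.
split.
  rewrite [LHS]mx11_scalar; congr (_%:M); apply: EFin_inj.
  rewrite -expectation_form unlock.
  rewrite (negligible_integral (measurableC mD) measurableT _ off_simplex_null).
    rewrite setTD setCK (eq_integral (cst 1%E)).
      by rewrite integral_cst // mul1e.
    by move=> v /set_mem[-> _]; rewrite mxE eqxx.
  rewrite (_ : (fun _ => _) = (fun v : borelV R n =>
    (\sum_(i <- index_enum 'I_n) ((v : 'cV[R]_n) i 0)%:E)%E)).
    by apply: integrable_sum => // i _; exact: integrable_coord.
  apply/funext => v; rewrite mxE -sumEFin; apply: eq_bigr => i _.
  by rewrite !mxE mul1r.
move=> i j; rewrite !mxE fine_ge0 // unlock.
rewrite (negligible_integral (measurableC mD) measurableT _ off_simplex_null);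
  last exact: integrable_coord.
rewrite setTD setCK; apply: integral_ge0 => v [_ v0].
by have := v0 i 0; rewrite lee_fin mxE.
Qed.

End ExpectationOnSimplex.

Lemma mean_vec_dirac (R : realType) n (a : 'cV[R]_n) :
  mean_vec (\d_(a : borelV R n) : probability (borelV R n) R) = a.
Proof.
apply/matrixP => i j; rewrite ord1 mxE unlock integral_dirac //.
  by rewrite diracT mul1e.
by apply/measurable_EFinP; exact: measurable_coord.
Qed.

(** * Mixed-integer encoding of the utility *)

Section Piece.
Variables (R : realType) (n : nat) (t : nat -> R).
Hypothesis t_incr : forall i, (i < n)%N -> t i < t i.+1.

Lemma breakpoints_lt i j : (i < j)%N -> (j <= n)%N -> t i < t j.
Proof.
elim: j => // j IH; rewrite ltnS leq_eqVlt => /predU1P[->|ij] jn.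
  exact: t_incr.
by apply: lt_trans (t_incr jn); apply: IH => //; exact: ltnW.
Qed.

Lemma breakpoints_le i j : (i <= j)%N -> (j <= n)%N -> t i <= t j.
Proof.
by rewrite leq_eqVlt => /predU1P[-> //|ij] jn; apply/ltW/breakpoints_lt.
Qed.

(** The defining sum has only the term of the half-open interval containing x.
The closed interval is allowed here: at the left end t k the active term is
the one of index k - 1 (or none if k = 0), and it takes the same value since
the marginal utility is continuous. *)
Lemma marginal_utility_piece (v : 'cV[R]_n) (x : R) (k : 'I_n) :
  t k <= x <= t k.+1 ->
  marginal_utility t x v =
    v k 0 / (t k.+1 - t k) * (x - t k) + \sum_(j < n | (j < k)%N) v j 0.
Proof.
have indic_eq0 (r : R) (i k' : nat) : (i < n)%N -> (k' < n)%N -> i != k' ->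
    t k' < r <= t k'.+1 -> (t i < r <= t i.+1) = false.
  move=> i_n kn ik /andP[x1 x2]; apply/negbTE/negP => /andP[y1 y2].
  move: ik; rewrite neq_ltn => /orP[ik|ki].
    by have := le_trans y2 (breakpoints_le ik (ltnW kn)); rewrite leNgt x1.
  by have := lt_le_trans y1 (le_trans x2 (breakpoints_le ki (ltnW i_n))); rewrite ltxx.
move=> /andP[]; rewrite le_eqVlt => /predU1P[<- _|kx xk1]; last first.
  rewrite /marginal_utility (bigD1 k) //= kx xk1 mulr1.
  rewrite [X in _ + X = _]big1 ?addr0 // => i ik.
  by rewrite (indic_eq0 _ i k) ?kx ?mulr0.
rewrite subrr mulr0 add0r /marginal_utility.
case: k => -[|k] kn /=.
  rewrite [RHS]big_pred0 // big1 // => i _.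
  by rewrite ltNge (breakpoints_le (leq0n i) (ltnW (ltn_ord i))) mulr0.
pose k' := Ordinal (ltnW kn).
have tkk : t k < t k.+1 by apply: t_incr; exact: ltnW.
rewrite (bigD1 k') //= tkk lexx mulr1 divfK; last by rewrite subr_eq0 gt_eqF.
rewrite [RHS](bigD1 k') //= [X in _ + X]big1 ?addr0 => [|i ik].
  by congr (_ + _); apply: eq_bigl => i; rewrite ltnS ltn_neqAle andbC.
by rewrite (indic_eq0 _ i k' (ltn_ord i) (ltn_ord k') ik) ?mulr0 //= tkk lexx.
Qed.

Lemma breakpoint_bracket x : (0 < n)%N -> t 0%N <= x <= t n ->
  exists k : 'I_n, t k <= x <= t k.+1.
Proof.
move=> n_gt0 /andP[t0x xtn].
have [//|k tkx kmax] := @arg_maxnP _ (Ordinal n_gt0) (fun k : 'I_n => t k <= x) val.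
exists k; rewrite tkx /=; have := ltn_ord k; rewrite leq_eqVlt => /predU1P[->//|k1n].
rewrite leNgt; apply/negP => /ltW /(kmax (Ordinal k1n)) /=.
by rewrite ltnn.
Qed.

End Piece.

(** The diagonal blocks Y_m and Z_m of [matY] and [matZ]. *)
Definition blockY (R : realType) (n : nat) (t : nat -> R) : 'M[R]_n :=
  diag_mx (\row_(i < n) (t i.+1 - t i)^-1).

Definition blockZ (R : realType) (n : nat) (t : nat -> R) : 'M[R]_n :=
  \matrix_(i < n, j < n)
    (if (i : nat) == j then - t i / (t i.+1 - t i)
     else if (i < j)%N then 1 else 0).

Lemma block_utility (R : realType) n (t : nat -> R) (v : 'cV[R]_n) x (k : 'I_n) :
  (forall i, (i < n)%N -> t i < t i.+1) -> t k <= x <= t k.+1 ->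
  marginal_utility t x v =
  ((blockY n t *m (x *: delta_mx k 0) + blockZ n t *m (delta_mx k 0 : 'cV[R]_n))^T
    *m v) 0 0.
Proof.
move=> t_incr tkx; rewrite (marginal_utility_piece t_incr v tkx).
rewrite -scalemxAr -!colE [RHS]mxE [RHS](bigD1 k) //= !mxE !eqxx mulr1n.
congr (_ + _); first by ring.
rewrite [LHS]big_mkcond [RHS]big_mkcond; apply: eq_bigr => i _; rewrite !mxE.
rewrite val_eqE eq_sym; case: eqVneq => [->|ik]; first by rewrite ltnn.
by rewrite mulr0n mulr0 add0r; case: ifP => _; rewrite ?mul1r ?mul0r.
Qed.

Lemma lemx_block (R : realType) M (p : 'I_M -> nat) n
    (a b : 'M[R]_(\sum_(m < M) p m, n)) :
  lemx a b <-> forall m, lemx (submxcol a m) (submxcol b m).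
Proof.
split=> h; first by move=> m i j; rewrite !mxE.
by move=> s j; have := h _ (tagnat.sig2 s) j; rewrite !mxE tagnat.sig2K.
Qed.

(** The constraints of the program which link y and z to the decision x. *)
Definition encodes (R : realType) M (p : 'I_M -> nat) (t : 'I_M -> nat -> R)
    (x : 'cV[R]_M) (y z : 'cV[R]_(\sum_(m < M) p m)) : Prop :=
  [/\ (matE R p)^T *m z = const_mx 1, (matE R p)^T *m y = x,
      lemx (matHminus p t *m z - y) 0, lemx 0 (matHplus p t *m z - y) &
      forall i, z i 0 = 0 \/ z i 0 = 1].

Section Encoding.
Variables (R : realType) (M : nat) (p : 'I_M -> nat) (t : 'I_M -> nat -> R).
Local Notation n := (\sum_(m < M) p m)%N.
Hypothesis t_incr : forall m i, (i < p m)%N -> t m i < t m i.+1.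

Lemma matE_colsum (z : 'cV[R]_n) m :
  ((matE R p)^T *m z) m 0 = \sum_(i < p m) submxcol z m i 0.
Proof.
rewrite -{1}(submxcolK z) tr_mxcol mul_mxrow_mxcol summxE (bigD1 m) //=.
rewrite [X in _ + X]big1 => [|l lm].
  by rewrite addr0 mxE; apply: eq_bigr => i _; rewrite !mxE eqxx mul1r.
rewrite mxE big1 // => i _; rewrite !mxE.
by rewrite (negbTE lm) mul0r.
Qed.

Lemma submxcol_diag (d : forall m, 'rV[R]_(p m)) (z : 'cV[R]_n) m i :
  submxcol (\mxdiag_(m < M) diag_mx (d m) *m z) m i 0 = d m 0 i * submxcol z m i 0.
Proof.
by rewrite -{1}(submxcolK z) mul_mxdiag_mxcol mxcolK mul_diag_mx mxE.
Qed.

Lemma subE k (a b : 'cV[R]_k) i : (a - b) i 0 = a i 0 - b i 0.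
Proof. by rewrite !mxE. Qed.

(** In each block the 0/1 entries of z sum to 1, so exactly one of them is 1;
t_i z_i <= y_i <= t_(i+1) z_i then annihilates the other entries of y, and the
sum condition puts x_m in the remaining one. *)
Lemma encodesP x (y z : 'cV[R]_n) : encodes t x y z <->
  forall m, exists2 k : 'I_(p m), t m k <= x m 0 <= t m k.+1 &
    submxcol z m = delta_mx k 0 /\ submxcol y m = x m 0 *: delta_mx k 0.
Proof.
split.
  move=> [z1 yx Hm Hp zb] m.
  have zb' i : submxcol z m i 0 = 0 \/ submxcol z m i 0 = 1 by rewrite mxE.
  have z1' : \sum_i submxcol z m i 0 = 1 by rewrite -matE_colsum z1 mxE.
  have yx' : \sum_i submxcol y m i 0 = x m 0 by rewrite -matE_colsum yx.
  have bnd (i : 'I_(p m)) :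
      t m i * submxcol z m i 0 <= submxcol y m i 0 <= t m i.+1 * submxcol z m i 0.
    have := (lemx_block _ _).1 Hm m i 0; have := (lemx_block _ _).1 Hp m i 0.
    rewrite submxcol0 !submxcolB !subE !submxcol_diag => h1 h2.
    by move: h1 h2; rewrite !mxE subr_ge0 subr_le0 => -> ->.
  have [k zk] : exists k, submxcol z m k 0 = 1.
    apply/not_existsP => nz; move: z1'; rewrite big1 => [/eqP|i _].
      by rewrite eq_sym oner_eq0.
    by case: (zb' i) => // /nz.
  have zk0 i : i != k -> submxcol z m i 0 = 0.
    move=> ik; case: (zb' i) => // zi; move: z1'.
    rewrite (bigD1 k) //= (bigD1 i) //= zk zi.
    have : 0 <= \sum_(j < p m | (j != k) && (j != i)) submxcol z m j 0.
      by apply: sumr_ge0 => j _; case: (zb' j) => ->.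
    move: (bigop _ _ _) => s s0 s1; exfalso; clear -s0 s1; lra.
  have yk0 i : i != k -> submxcol y m i 0 = 0.
    by move=> ik; have := bnd i; rewrite zk0 // !mulr0 => /le_anti.
  have yk : submxcol y m k 0 = x m 0.
    by rewrite -yx' (bigD1 k) //= big1 ?addr0 // => i; exact: yk0.
  exists k; first by have := bnd k; rewrite yk zk !mulr1.
  split; apply/colP => i; rewrite [RHS]mxE ?[delta_mx _ _ _ _]mxE eqxx andbT.
    by have [->|/zk0] := eqVneq i k.
  by have [->|/yk0 ->] := eqVneq i k; rewrite ?mulr1 ?mulr0.
move=> h.
have d_sum m (k : 'I_(p m)) : \sum_i (delta_mx k 0 : 'cV[R]_(p m)) i 0 = 1.
  rewrite (bigD1 k) //= mxE !eqxx big1 ?addr0 // => i ik.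
  by rewrite mxE (negbTE ik).
split.
- apply/colP => m; rewrite matE_colsum; have [k _ [-> _]] := h m.
  by rewrite d_sum mxE.
- apply/colP => m; rewrite matE_colsum; have [k _ [_ ->]] := h m.
  by under eq_bigr do rewrite mxE; rewrite -mulr_sumr d_sum mulr1.
- apply/lemx_block => m i j; rewrite ord1 submxcol0 submxcolB.
  rewrite subE submxcol_diag; have [k /andP[k1 k2] [-> ->]] := h m.
  rewrite !mxE eqxx andbT; have [->|_] := eqVneq i k; rewrite ?mulr1 ?mulr0 ?subr0 //.
  by rewrite subr_le0.
- apply/lemx_block => m i j; rewrite ord1 submxcol0 submxcolB.
  rewrite subE submxcol_diag; have [k /andP[k1 k2] [-> ->]] := h m.
  rewrite !mxE eqxx andbT; have [->|_] := eqVneq i k; rewrite ?mulr1 ?mulr0 ?subr0 //.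
  by rewrite subr_ge0.
move=> s; have [k _ [zd _]] := h (tagnat.sig1 s).
have /matrixP/(_ (tagnat.sig2 s) 0) := zd.
rewrite !mxE tagnat.sig2K => ->; rewrite eqxx andbT.
by case: eqP; [right|left].
Qed.

Lemma encodes_utility x (y z : 'cV[R]_n) v : encodes t x y z ->
  utility t x v = ((matY p t *m y + matZ p t *m z)^T *m v) 0 0.
Proof.
move=> /encodesP h.
rewrite -{1}(submxcolK y) -{1}(submxcolK z) !mul_mxdiag_mxcol -mxcolD.
rewrite -[in RHS](submxcolK v) tr_mxcol mul_mxrow_mxcol summxE.
apply: eq_bigr => m _; have [k tkx [-> ->]] := h m.
by rewrite (block_utility _ (@t_incr m) tkx).
Qed.

Lemma encoding_exists x : (forall m, (0 < p m)%N) -> attribute_box p t x ->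
  exists y z : 'cV[R]_n, encodes t x y z.
Proof.
move=> p_gt0 xbox.
pose k m := projT1 (cid (breakpoint_bracket (p_gt0 m) (xbox m))).
exists (\mxcol_m (x m 0 *: delta_mx (k m) 0)), (\mxcol_m delta_mx (k m) 0).
apply/encodesP => m; exists (k m); last by rewrite !mxcolK.
exact: projT2 (cid (breakpoint_bracket (p_gt0 m) (xbox m))).
Qed.

End Encoding.

(** * Replacing an inner minimum by its dual *)

(** An outer maximization over x of an inner minimization over P is compared
with a maximization over points u that carry a decision [proj u].  The
objective f u bounds the inner minimum from below, and for each x either this
bound is attained together with the minimum, or it is unbounded while there is
no P at all. *)
Section MaximinReformulation.
Variables (R : realType) (T Q U : Type) (X : set T) (PB : set Q).
Variables (g : T -> Q -> \bar R) (F : set U) (proj : U -> T) (f : U -> R).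
Hypothesis weak : forall u, F u ->
  X (proj u) /\ forall P, PB P -> ((f u)%:E <= g (proj u) P)%E.
Hypothesis strong : forall x, X x ->
  (exists P u, [/\ PB P, F u, proj u = x & g x P = (f u)%:E]) \/
  (PB = set0 /\ forall r, exists u, [/\ F u, proj u = x & r <= f u]).

Let obj u := (f u)%:E.

Lemma maximin_weak u : F u -> (obj u <= worst_case PB g (proj u))%E.
Proof.
by move=> /weak[_ h]; apply: le_ereal_inf_tmp => _ [P PBP <-]; exact: h.
Qed.

Lemma maximin_attained x P u : PB P -> F u -> proj u = x -> g x P = obj u ->
  worst_case PB g x = obj u.
Proof.
move=> PBP Fu <- E; apply/le_anti/andP; split; last exact: maximin_weak.
by rewrite -E; apply: ereal_inf_lbound; exists P.
Qed.

Lemma maximin_value : sup_value X (worst_case PB g) = sup_value F obj.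
Proof.
apply/le_anti/andP; split; apply: ge_ereal_sup => _ [x Xx <-].
  have [[P [u [PBP Fu ux E]]]|[_ unb]] := strong Xx.
    rewrite (maximin_attained PBP Fu ux E).
    by apply: ereal_sup_ubound; exists u.
  suff -> : sup_value F obj = +oo%E by rewrite leey.
  apply: eq_infty => r; have [u [Fu _ ru]] := unb r.
  by apply: le_ereal_sup_tmp; exists (obj u); [exists u|rewrite lee_fin].
apply: (le_trans (maximin_weak Xx)); apply: ereal_sup_ubound.
by exists (proj x) => //; have [] := weak Xx.
Qed.

Lemma maximin_decisionsE :
  maximin_decisions X PB g = proj @` maximizers F obj.
Proof.
apply/seteqP; split=> x.
  move=> [[Xx xmax] [P PBP _]]; have [[P' [u [PBP' Fu ux E]]]|[PB0 _]] := strong Xx.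
    exists u => //; split=> // u' Fu'.
    rewrite -(maximin_attained PBP' Fu ux E); apply: le_trans (maximin_weak Fu') _.
    by apply: xmax; have [] := weak Fu'.
  by move: PBP; rewrite PB0.
move=> [u [Fu umax] ux].
have unb y : ~ forall r, exists u', [/\ F u', proj u' = y & r <= f u'].
  move=> /(_ (f u + 1))[u' [Fu' _]]; have := umax _ Fu'; rewrite lee_fin => h1 h2.
  by have := le_trans h2 h1; rewrite gerDl ler10.
have Xx : X x by rewrite -ux; have [] := weak Fu.
have [[P [u' [PBP Fu' u'x E]]]|[_ /unb //]] := strong Xx.
have wx := maximin_attained PBP Fu' u'x E.
split; last by exists P => //; rewrite wx.
split=> // y Xy; have [[P' [v [PBP' Fv vy E']]]|[_ /unb //]] := strong Xy.
rewrite (maximin_attained PBP' Fv vy E'); apply: (le_trans (umax _ Fv)).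
by rewrite -ux; exact: maximin_weak.
Qed.

End MaximinReformulation.

(** * The inner linear program *)

(** C m + G w = vbar, with m and w ranging over simplices, is the inner problem
in equality form; pi and tau are the multipliers of the normalizations of w
and of m. *)
Section InnerDuality.
Variables (R : realType) (n k q : nat) (C : 'M[R]_(k, n)) (G : 'M[R]_(k, q)).
Variable vbar : 'cV[R]_k.

Definition inner_primal (m : 'cV[R]_n) (w : 'cV[R]_q) : Prop :=
  [/\ unit_simplex m, unit_simplex w & C *m m + G *m w = vbar].

Definition inner_dual (g : 'cV[R]_n) (eta : 'cV[R]_k) (pi tau : R) : Prop :=
  lemx (C^T *m eta + tau *: const_mx 1) g /\
  lemx (G^T *m eta + pi *: const_mx 1) 0.

Definition inner_value (eta : 'cV[R]_k) (pi tau : R) : R :=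
  (vbar^T *m eta) 0 0 + pi + tau.

Let A : 'M[R]_(k + (1 + 1), n + q) :=
  col_mx (row_mx C G)
    (col_mx (row_mx 0 (const_mx 1)) (row_mx (const_mx 1) 0)).
Let b : 'cV[R]_(k + (1 + 1)) := col_mx vbar (col_mx 1%:M 1%:M).

Lemma inner_primalE m w :
  inner_primal m w <-> lemx 0 (col_mx m w) /\ A *m col_mx m w = b.
Proof.
rewrite lemx0_col_mx /A /b !mul_col_mx !mul_row_col !mul0mx addr0 add0r.
rewrite /inner_primal /unit_simplex /= !trmx_const; split.
  by move=> [[-> m0] [-> w0] ->].
by move=> [[m0 w0] /eq_col_mx[-> /eq_col_mx[-> ->]]].
Qed.

Lemma inner_dualE g eta pi tau : inner_dual g eta pi tau <->
  lemx (A^T *m col_mx eta (col_mx pi%:M tau%:M)) (col_mx g 0).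
Proof.
rewrite /A !tr_col_mx !tr_row_mx !mul_row_col !mul_col_mx !trmx0 !mul0mx.
rewrite !add_col_mx !trmx_const add0r addr0 !mul_mx_scalar.
by rewrite lemx_col_mx.
Qed.

Lemma inner_valueE eta pi tau :
  inner_value eta pi tau = (b^T *m col_mx eta (col_mx pi%:M tau%:M)) 0 0.
Proof.
rewrite /b !tr_col_mx !mul_row_col !tr_scalar_mx !mul1mx addrA.
by rewrite [RHS]mxE [X in _ = X + _]mxE [pi%:M _ _]mxE [tau%:M _ _]mxE eqxx !mulr1n.
Qed.

Lemma inner_weak g m w eta pi tau :
  inner_primal m w -> inner_dual g eta pi tau ->
  inner_value eta pi tau <= (g^T *m m) 0 0.
Proof.
move=> /inner_primalE[mw0 Emw] /inner_dualE d.
rewrite inner_valueE -Emw trmx_mul -mulmxA.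
apply: le_trans (mulmx_monor mw0 d) _.
by rewrite tr_col_mx mul_row_col mulmx0 addr0 trmx_form.
Qed.

Lemma inner_strong g :
  (exists m w eta pi tau, [/\ inner_primal m w, inner_dual g eta pi tau &
     (g^T *m m) 0 0 = inner_value eta pi tau]) \/
  ((forall m w, ~ inner_primal m w) /\
   forall r, exists eta pi tau, inner_dual g eta pi tau /\ r <= inner_value eta pi tau).
Proof.
have splitE (y : 'cV[R]_(k + (1 + 1))) :
    y = col_mx (usubmx y) (col_mx (usubmx (dsubmx y) 0 0)%:M (dsubmx (dsubmx y) 0 0)%:M).
  by rewrite -!mx11_scalar !vsubmxK.
(* tau = - sum_i |g_i| lies below every coefficient of g. *)
have [y0 y0d] : exists y, lemx (A^T *m y) (col_mx g 0).
  exists (col_mx 0 (col_mx 0%:M (- \sum_i `|g i 0|)%:M)); apply/inner_dualE.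
  split; last by rewrite mulmx0 scale0r addr0 => i j.
  rewrite mulmx0 add0r => i j; rewrite ord1 !mxE mulr1 lerNl.
  rewrite (bigD1 i) //=; apply: (@le_trans _ _ `|g i 0|).
    by rewrite -normrN ler_norm.
  by rewrite lerDl; apply: sumr_ge0.
have [|[x [y [x0 Ax yd xy]]]|[y yd y_gt0]] := @lp_duality R _ _ A b (col_mx g 0).
- by exists y0.
- left; exists (usubmx x), (dsubmx x), (usubmx y).
  exists (usubmx (dsubmx y) 0 0), (dsubmx (dsubmx y) 0 0).
  split; [by apply/inner_primalE; rewrite vsubmxK|by apply/inner_dualE; rewrite -splitE|].
  rewrite inner_valueE -splitE -xy -{2}(vsubmxK x) tr_col_mx mul_row_col.
  by rewrite trmx0 mul0mx addr0.
right; split.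
  move=> m w /inner_primalE[mw0 Emw]; move: y_gt0; rewrite -Emw trmx_mul -mulmxA.
  by rewrite ltNge (le_trans (mulmx_monor mw0 yd)) // mulmx0 mxE.
(* Far enough along the ray y from y0 the dual value exceeds r. *)
move=> r; set val0 := (b^T *m y0) 0 0; set val := (b^T *m y) 0 0 in y_gt0.
pose s := `|r - val0| / val.
have s_ge0 : 0 <= s by rewrite divr_ge0 // ltW.
pose ys := y0 + s *: y.
exists (usubmx ys), (usubmx (dsubmx ys) 0 0), (dsubmx (dsubmx ys) 0 0); split.
  apply/inner_dualE; rewrite -splitE mulmxDr -scalemxAr => i j.
  rewrite [leLHS]mxE -[leRHS]addr0 lerD //.
  by rewrite [leLHS]mxE mulr_ge0_le0 //; have := yd i j; rewrite [leRHS]mxE.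
rewrite inner_valueE -splitE mulmxDr -scalemxAr mxE -/val0 [X in _ + X]mxE -/val.
by rewrite divfK ?gt_eqF // -lerBlDl ler_norm.
Qed.

End InnerDuality.

(** * The reformulation *)

Lemma confidence_regionP (R : realType) n q N (vbar : 'cV[R]_n.-1) L
    (That : 'M[R]_(n.-1, q)) (G := (Num.sqrt N%:R)^-1 *: (L *m That)) (m : 'cV[R]_n) :
  (confidence_region N vbar L That (matC R n *m m) <->
   exists2 w, unit_simplex w & matC R n *m m + G *m w = vbar).
Proof.
rewrite /G; split=> [[_ [w w1 <-] E]|[w w1 E]].
  by exists w => //; rewrite -E -scalemxAl mulmxA subrK.
exists (That *m w); first by exists w.
by rewrite -E -scalemxAl mulmxA addrK.
Qed.

(** P contributes its mean, and conversely the primal point (m, w) contributes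
the Dirac mass at m. *)
Lemma expected_utility_primal (R : realType) M (p : 'I_M -> nat)
    (t : 'I_M -> nat -> R) q N
    (n := (\sum_(m < M) p m)%N) (vbar : 'cV[R]_n.-1) L (That : 'M[R]_(n.-1, q))
    (G := (Num.sqrt N%:R)^-1 *: (L *m That))
    (PB := ambiguity_set (confidence_region N vbar L That))
    (x : 'cV[R]_M) (g : 'cV[R]_n) :
  (forall v, utility t x v = (g^T *m v) 0 0) ->
  (forall P, PB P -> exists m w, inner_primal (matC R n) G vbar m w /\
     expected_utility t x P = ((g^T *m m) 0 0)%:E) /\
  (forall m w, inner_primal (matC R n) G vbar m w -> exists2 P, PB P &
     expected_utility t x P = ((g^T *m m) 0 0)%:E).
Proof.
move=> gE.
have EP (P : probability (borelV R n) R) :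
    P (@unit_simplex R n : set (borelV R n)) = 1%E ->
    expected_utility t x P = ((g^T *m mean_vec P) 0 0)%:E.
  move=> P1; rewrite -(expectation_form P1) /expected_utility.
  by congr expectation; apply/funext => v; exact: gE.
split.
  move=> P [P1 /confidence_regionP[w w1 E]].
  exists (mean_vec P), w; split; last exact: EP.
  by split => //; exact: mean_vec_simplex.
move=> m w [m1 w1 E].
pose P : probability (borelV R n) R := \d_(m : borelV R n).
have P1 : P (@unit_simplex R n : set (borelV R n)) = 1%E.
  by rewrite /P /= diracE mem_set.
exists P; last by rewrite EP // mean_vec_dirac.
by split => //; rewrite mean_vec_dirac; apply/confidence_regionP; exists w.
Qed.

(** The dual program written with the coefficients Y y + Z z of any encoding
(y, z) of x, maximized jointly over x, its encodings and the multipliers. *)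
Lemma maximin_milp (R : realType) M (p : 'I_M -> nat) (t : 'I_M -> nat -> R) q N
    (n := (\sum_(m < M) p m)%N) (vbar : 'cV[R]_n.-1) L (That : 'M[R]_(n.-1, q))
    (X : set 'cV[R]_M)
    (PB := ambiguity_set (confidence_region N vbar L That))
    (feas := milp_feasible t X N L That)
    (obj := milp_objective (M := M) vbar) :
  (forall m, (0 < p m)%N) ->
  (forall m i, (i < p m)%N -> t m i < t m i.+1) ->
  X `<=` attribute_box p t ->
  sup_value X (worst_case PB (expected_utility t)) = sup_value feas obj /\
  maximin_decisions X PB (expected_utility t)
  = @milp_x R M n @` maximizers feas obj.
Proof.
move=> p_gt0 t_incr Xbox.
pose G := (Num.sqrt N%:R)^-1 *: (L *m That).
have GE (eta : 'cV_n.-1) : G^T *m eta = (Num.sqrt N%:R)^-1 *: (That^T *m L^T *m eta).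
  by rewrite /G linearZ /= trmx_mul -scalemxAl.
pose coef (y z : 'cV[R]_n) := matY p t *m y + matZ p t *m z.
have feasE x y z eta pi tau : feas (MilpPoint x y z eta pi tau) <->
    [/\ X x, encodes t x y z & inner_dual (matC R n) G (coef y z) eta pi tau].
  rewrite /feas /milp_feasible /inner_dual GE /encodes; split.
    by move=> [d1 d2 [z1 yx] [Hm Hp] [zb Xx]].
  by move=> [Xx [z1 yx Hm Hp zb] [d1 d2]].
pose val (u : milp_point R M n) := inner_value vbar (milp_eta u) (milp_pi u) (milp_tau u).
have weak u : feas u -> X (milp_x u) /\
    forall P, PB P -> ((val u)%:E <= expected_utility t (milp_x u) P)%E.
  case: u => x y z eta pi tau /feasE[Xx enc d]; split => // P.
  move=> /((expected_utility_primal _ _ _ _ (fun v => encodes_utility t_incr v enc)).1 P).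
  by move=> [m [w [mw ->]]]; rewrite lee_fin; exact: inner_weak mw d.
have strong x : X x ->
    (exists P u, [/\ PB P, feas u, milp_x u = x & expected_utility t x P = (val u)%:E]) \/
    (PB = set0 /\ forall r, exists u, [/\ feas u, milp_x u = x & r <= val u]).
  move=> Xx; have [y [z enc]] := encoding_exists p_gt0 (Xbox _ Xx).
  have [toLP ofLP] := @expected_utility_primal _ _ _ _ q N vbar L That _ _
    (fun v => encodes_utility t_incr v enc).
  have [[m [w [eta [pi [tau [mw d E]]]]]]|[noprim unb]] :=
      inner_strong (matC R n) G vbar (coef y z).
    left; have [P PBP PE] := ofLP _ _ mw.
    exists P, (MilpPoint x y z eta pi tau); split => //; first exact/feasE.
    by rewrite PE E.
  right; split.
    by apply/seteqP; split => // P /toLP[m [w [/noprim]]].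
  move=> r; have [eta [pi [tau [d rv]]]] := unb r.
  by exists (MilpPoint x y z eta pi tau); split => //; exact/feasE.
split; [exact: (maximin_value weak strong)|exact: (maximin_decisionsE weak strong)].
Qed.

Theorem proposition3 (R : realType)
    (M : nat) (p : 'I_M -> nat) (t : 'I_M -> nat -> R)
    (N K : nat) (alpha : R)
    (mu : probability (borelV R (\sum_(m < M) p m)) R)
    (d : measure_display) (Om : measurableType d) (Pr : probability Om R)
    (V : 'I_N -> Om -> borelV R (\sum_(m < M) p m))
    (J : 'I_K -> 'I_N -> Om -> 'I_N)
    (w : Om)
    (L : 'M[R]_((\sum_(m < M) p m).-1))
    (Lstar : 'I_K -> 'M[R]_((\sum_(m < M) p m).-1))
    (Tord : seq 'cV[R]_((\sum_(m < M) p m).-1))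
    (X : set 'cV[R]_M) :
  let n := (\sum_(m < M) p m)%N in
  let C := matC R n in
  (0 < M)%N ->
  (forall m, (0 < p m)%N) ->
  (forall m i, (i < p m)%N -> t m i < t m i.+1) ->
  mu (@unit_simplex R n : set (borelV R n)) = 1%E ->
  cov_mx mu C \in unitmx ->
  (0 < N)%N ->
  (0 < K)%N ->
  bootstrap_sampling Pr mu V J ->
  let Vw : 'I_N -> 'cV[R]_n := fun j => V j w in
  let rw : 'I_K -> 'I_N -> 'I_N := fun k j => J k j w in
  let Vbar := C *m sample_mean Vw in
  let S := C *m sample_cov Vw *m C^T in
  S \in unitmx ->
  is_sqrt_mx S L ->
  (forall k, sample_cov (resample Vw rw k) \in unitmx) ->
  (forall k, is_sqrt_mx (sample_cov (resample Vw rw k)) (Lstar k)) ->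
  depth_ordered (boot_stat Vw rw Lstar) Tord ->
  0 < alpha < 1 ->
  X `<=` attribute_box p t ->
  let That : 'M[R]_(n.-1, depth_count alpha K) :=
    mat_That (depth_count alpha K) Tord in
  let PB : set (probability (borelV R n) R) :=
    ambiguity_set (confidence_region N Vbar L That) in
  let feas := milp_feasible t X N L That in
  let obj := milp_objective (M := M) Vbar in
  sup_value X (worst_case PB (expected_utility t)) = sup_value feas obj /\
  maximin_decisions X PB (expected_utility t)
  = @milp_x R M n @` maximizers feas obj.
Proof. by move=> n C _ ? ? *; exact: maximin_milp. Qed.
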